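(* Let $Q$ be a quiver, $\alpha\geq1$ and $\mathbf{r}=\underline{1}=(1,\ldots,1)\in\mathbb{Z}_{\geq 0}^{Q_0}$. Then the counting polynomial $A_{Q,\mathbf{r},\alpha}$ has non-negative coefficients; that is, $A_{Q,\underline{1},\alpha}\in\mathbb{Z}_{\geq0}[q]$.
   Context: A quiver $Q=(Q_0,Q_1,s,t)$ consists of finite sets of vertices $Q_0$ and arrows $Q_1$ with source and target maps $s,t:Q_1\to Q_0$ (loops and parallel arrows allowed). For $q$ a prime power, a locally free representation of $Q$ of rank $\underline{1}$ over $\mathcal{O}_\alpha=\mathbb{F}_q[t]/(t^\alpha)$ is a collection of free rank one $\mathcal{O}_\alpha$-modules $M_i$ ($i\in Q_0$) and $\mathcal{O}_\alpha$-linear maps $f_a:M_{s(a)}\to M_{t(a)}$ ($a\in Q_1$); isomorphisms are families of module isomorphisms commuting with the $f_a$. It is indecomposable if it is not a direct sum of two nonzero subrepresentations, and absolutely indecomposable if its base change to $\overline{\mathbb{F}_q}[t]/(t^\alpha)$ is indecomposable. $A_{Q,\underline{1},\alpha}(q)$ is the number of isomorphism classes of absolutely indecomposable locally free representations of $Q$ of rank $\underline{1}$ over $\mathbb{F}_q[t]/(t^\alpha)$. It is known (Hausel–Letellier–Rodriguez-Villegas, Wyss) that there is a unique polynomial with integer coefficients, also denoted $A_{Q,\underline{1},\alpha}$, whose value at every prime power $q$ is this number; explicitly, $A_{Q,\underline{1},\alpha}(q)=\sum_{E_1\subseteq\ldots\subseteq E_\alpha\subseteq Q_1,\ c(Q\restriction_{E_\alpha})=1}(q-1)^{b(Q\restriction_{E_\alpha})}q^{\sum_{k=1}^{\alpha-1}b(Q\restriction_{E_k})}$,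 where $Q\restriction_E$ has vertex set $Q_0$ and arrow set $E$, $c$ is the number of connected components and $b=c-\sharp\text{vertices}+\sharp\text{arrows}$. *)

(* Defs.v *)
From HB Require Import structures.
From mathcomp Require Import all_boot all_order all_algebra all_field.
From mathcomp Require Import boolp.

Set Implicit Arguments.
Unset Strict Implicit.
Unset Printing Implicit Defensive.

Import Order.TTheory GRing.Theory Num.Theory.
Local Open Scope ring_scope.

Record quiver := Quiver {
  vertex : finType;
  arrow : finType;
  src : arrow -> vertex;
  tgt : arrow -> vertex }.

Section Representations.

Variables (Q : quiver) (r : vertex Q -> nat).

(* Locally free representations of rank r over O, in coordinates: the free     *)
(* module at the vertex i is 'rV[O]_(r i), and the O-linear map at the arrow a *)
(* is v |-> v *m M a. Every locally free representation of rank r is           *)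
(* isomorphic to one of this form.                                             *)
Definition rep (O : nzRingType) :=
  {dffun forall a : arrow Q, 'M[O]_(r (src a), r (tgt a))}.

Definition rep_iso (O : comUnitRingType) (M N : rep O) : Prop :=
  exists g : forall i : vertex Q, 'M[O]_(r i),
    (forall i, g i \in unitmx) /\
    (forall a, M a *m g (tgt a) = g (src a) *m N a).

Definition vertex_sub (O : nzRingType) :=
  forall i : vertex Q, {pred 'rV[O]_(r i)}.

Definition subrep (O : nzRingType) (M : rep O) (U : vertex_sub O) : Prop :=
  (forall i, submod_closed (U i)) /\
  (forall a v, v \in U (src a) -> v *m M a \in U (tgt a)).

Definition sub_nonzero (O : nzRingType) (U : vertex_sub O) : Prop :=
  exists i, exists2 v, v \in U i & v != 0.

Definition direct_sum (O : nzRingType) (U W : vertex_sub O) : Prop :=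
  forall i,
    (forall v, exists u w, [/\ u \in U i, w \in W i & v = u + w]) /\
    (forall v, v \in U i -> v \in W i -> v = 0).

(* The zero representation is not counted as indecomposable. *)
Definition indecomposable (O : nzRingType) (M : rep O) : Prop :=
  sub_nonzero (fun i => predT : {pred 'rV[O]_(r i)}) /\
  ~ exists U W : vertex_sub O,
      [/\ subrep M U, subrep M W, sub_nonzero U, sub_nonzero W
        & direct_sum U W].

Definition base_change (O O' : nzRingType) (h : O -> O') (M : rep O) : rep O' :=
  [ffun a => map_mx h (M a)].

End Representations.

(* F[t]/(t^alpha). Pitfall: for alpha = 0 the library's quotient is by 'X. *)
Notation trunc_poly F alpha := {poly %/ ('X^alpha : {poly F})}.

Definition trunc_map (F K : fieldType) (f : F -> K) (alpha : nat)
    (x : trunc_poly F alpha) : trunc_poly K alpha :=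
  in_qpoly 'X^alpha (map_poly f (x : {poly F})).

Definition alg_closure (F : finFieldType) : countClosedFieldType :=
  tag (countable_algebraic_closure F).

Definition to_alg_closure (F : finFieldType) : {rmorphism F -> alg_closure F} :=
  sval (tagged (countable_algebraic_closure F)).

Section Counting.

Variables (Q : quiver) (r : vertex Q -> nat) (alpha : nat).

Definition abs_indecomposable (F : finFieldType)
    (M : rep r (trunc_poly F alpha)) : Prop :=
  indecomposable
    (base_change (@trunc_map F (alg_closure F) (to_alg_closure F) alpha) M).

Definition count_abs_indec (F : finFieldType) : nat :=
  #|equivalence_partition
      (fun M N : rep r (trunc_poly F alpha) => `[< rep_iso M N >])
      [set M | `[< abs_indecomposable M >]]|.

Definition counting_polynomial (A : {poly int}) : Prop :=
  forall F : finFieldType, A.[#|F|%:R] = (count_abs_indec F)%:R.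

End Counting.

(* Main.v *)
Require Import Defs.
From HB Require Import structures.
From mathcomp Require Import all_boot all_order all_algebra all_field.
From mathcomp Require Import boolp.

(** Write O for F[t]/(t^alpha). A representation of rank (1,...,1) assigns an
element of O to each arrow, and an isomorphism is a unit of O at each vertex,
acting by f_a |-> g_(source a)^-1 f_a g_(target a). As O is local, a direct
sum decomposition gives each vertex wholly to one of the two summands, so
a representation is indecomposable when there is a vertex and the arrows with
f_a <> 0 connect the vertices (indecomposable_rank1). Scalar extension preserves the support, so
this also decides absolute indecomposability (abs_indecomposable_connects),
and what has to be counted are the orbits of gauge transformations on labellings
f with connected support.

The orbits are counted by running Kruskal's algorithm on the valuations of the
f_a, ties being broken by a fixed order on the arrows. Among the arrows that are
not loops let e be the first one of least valuation v. A gauge transformation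
makes f_e = t^v (gauge_pivot). The transformations that keep f_e satisfy
t^v g_i = t^v g_j, where i and j are the ends of e; since t^v divides every other
label of a non-loop, they act on these labels as if g_i = g_j. So the orbits
with given (e, v) are the orbits of the quiver in which e is contracted
(gauge_lift, gauge_descend), under the constraint that e was first: the label of
an arrow a <> e that was not a loop is divisible by t^v, and by t^(v+1) if a
comes before e. When one vertex is left all arrows are loops, the
action is trivial, and the labels are arbitrary multiples of t^(m_a) for the
accumulated bounds m_a: there are q^(sum of (alpha - m_a)) of them. Hence the
number of orbits is a sum of powers of q, indexed by data that do not depend
on F, and the polynomial orbit_poly has non-negative coefficients.

The recursion is run twice, once for the polynomial and once for a set
normal_forms of representatives; normal_forms_cover, normal_forms_inj
and card_normal_forms say that this set is a transversal of the size given by the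
polynomial. Uniqueness of the polynomial holds because there are finite fields
of order 2^k for all k > 0. *)

Set Implicit Arguments.
Unset Strict Implicit.
Unset Printing Implicit Defensive.
Import Order.TTheory GRing.Theory Num.Theory.
Local Open Scope ring_scope.

(** * Valuations in truncated polynomial rings *)

Section TruncatedPolynomials.
Variables (F : fieldType) (alpha : nat).
Hypothesis alpha_gt0 : (0 < alpha)%N.

Local Notation O := (trunc_poly F alpha).
Local Notation polyO x := (x : {poly F}) (only parsing).

Definition tpow (k : nat) : O := in_qpoly 'X^alpha 'X^k.

(** Divisibility by t^k is tested on the representative of degree less than
alpha, so that the same test is valid for all k: for k >= alpha it forces x = 0,
in agreement with t^k = 0. *)
Definition tdvd (k : nat) (x : O) : bool := 'X^k %| polyO x.

Let modulusE : mk_monic ('X^alpha : {poly F}) = 'X^alpha.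
Proof. by rewrite /mk_monic size_polyXn ltnS alpha_gt0 monicXn. Qed.

Lemma size_trunc (x : O) : (size (polyO x) <= alpha)%N.
Proof.
have sizeE : size (mk_monic ('X^alpha : {poly F})) = alpha.+1.
  by rewrite modulusE size_polyXn.
rewrite -ltnS -[X in (_ < X)%N]sizeE; exact: size_mk_monic.
Qed.

Lemma trunc_small (p : {poly F}) :
  (size p <= alpha)%N -> polyO (in_qpoly 'X^alpha p) = p.
Proof. by move=> sp; rewrite in_qpoly_small // modulusE size_polyXn ltnS. Qed.

Lemma truncK (x : O) : in_qpoly 'X^alpha (polyO x) = x.
Proof. by apply: val_inj; apply: trunc_small; apply: size_trunc. Qed.

Lemma tdvd_trunc k (p : {poly F}) : (k <= alpha)%N ->
  tdvd k (in_qpoly 'X^alpha p) = ('X^k %| p).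
Proof.
move=> le_k; rewrite /tdvd /= modulusE -(Pdiv.IdomainMonic.modpE (monicXn _ _)).
by rewrite -dvdp_mod // dvdp_exp2l.
Qed.

Lemma tdvd_eq0 k x : (alpha <= k)%N -> tdvd k x = (x == 0).
Proof.
move=> le_k; apply/idP/eqP => [|->]; last exact: dvdp0.
move=> dv; apply: val_inj; apply/eqP => /=; apply: contraTT dv => nz.
apply/negP => /(dvdp_leq nz); rewrite size_polyXn ltnNge.
by rewrite (leq_trans (size_trunc x)).
Qed.

Lemma tpow_eq0 k : (alpha <= k)%N -> tpow k = 0.
Proof.
move=> le_k; apply/eqP; rewrite -(tdvd_eq0 _ (leqnn _)) tdvd_trunc //.
exact: dvdp_exp2l.
Qed.

Lemma tdvdP k (x : O) : reflect (exists y, x = y * tpow k) (tdvd k x).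
Proof.
apply: (iffP idP) => [/dvdpP [p def_x]|[y ->]].
  by exists (in_qpoly _ p); rewrite /tpow -in_qpolyM -def_x truncK.
have [le_ak|/ltnW le_ka] := leqP alpha k.
  by rewrite tpow_eq0 // mulr0 tdvd_eq0.
by rewrite -(truncK y) /tpow -in_qpolyM tdvd_trunc // dvdp_mulIr.
Qed.

Lemma tdvdW j k x : (j <= k)%N -> tdvd k x -> tdvd j x.
Proof. by move=> le_jk; apply/dvdp_trans/dvdp_exp2l. Qed.

Lemma tdvd_mulr k x y : tdvd k x -> tdvd k (x * y).
Proof.
by move=> /tdvdP[z ->]; apply/tdvdP; exists (z * y); rewrite mulrAC.
Qed.

Lemma tdvd_unitM k u x : u \is a GRing.unit -> tdvd k (u * x) = tdvd k x.
Proof.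
move=> uU; apply/idP/idP => [|]; last by rewrite mulrC; apply: tdvd_mulr.
by move/(@tdvd_mulr _ _ u^-1); rewrite mulrC mulKr.
Qed.

Lemma tdvd_tpow j k : (j < alpha)%N -> tdvd k (tpow j) = (k <= j)%N.
Proof.
move=> lt_j; rewrite /tdvd trunc_small ?size_polyXn //.
by rewrite dvdp_Pexp2l // size_polyX.
Qed.

(** The units are the truncated polynomials with non-zero constant term, because
coprimality with a power of t is coprimality with t. *)
Lemma trunc_unitE (x : O) : (x \is a GRing.unit) = ~~ tdvd 1 x.
Proof.
transitivity (coprimep (mk_monic ('X^alpha : {poly F})) (polyO x)) => //.
rewrite [X in coprimep X _]modulusE coprimep_pexpl // coprimep_sym /tdvd expr1.
by have := coprimep_XsubC (polyO x) 0; rewrite subr0 => ->; rewrite -dvdp_XsubCl subr0.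
Qed.

Lemma trunc_local (u w : O) :
  u + w = 1 -> (u \is a GRing.unit) || (w \is a GRing.unit).
Proof.
move=> uw1; rewrite !trunc_unitE -negb_and; apply/negP => /andP[u1 w1].
have /idP[] : ~~ tdvd 1 (1 : O) by rewrite -trunc_unitE unitr1.
by rewrite -uw1 /tdvd poly_of_qpolyD dvdp_add.
Qed.

Lemma exact_tdvd k x : tdvd k x -> ~~ tdvd k.+1 x ->
  exists2 u, u \is a GRing.unit & x = u * tpow k.
Proof.
move=> /dvdpP[p def_x] ndv; exists (in_qpoly _ p).
  rewrite trunc_unitE tdvd_trunc //; apply: contra ndv => dv.
  by rewrite /tdvd def_x exprS dvdp_mul.
by rewrite /tpow -in_qpolyM -def_x truncK.
Qed.

Lemma tpow_neq0 k : (k < alpha)%N -> tpow k != 0.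
Proof.
by move=> lt_k; rewrite -(tdvd_eq0 _ (leqnn _)) tdvd_tpow // -ltnNge.
Qed.

End TruncatedPolynomials.

Lemma card_tdvd (F : finFieldType) alpha k : (0 < alpha)%N ->
  #|[set x : trunc_poly F alpha | tdvd k x]| = (#|F| ^ (alpha - k))%N.
Proof.
move=> alpha_gt0; have [le_ak|/ltnW le_ka] := leqP alpha k.
  rewrite (eqP le_ak) expn0 -(cards1 (0 : trunc_poly F alpha)).
  by apply: eq_card => x; rewrite !inE tdvd_eq0.
rewrite -card_npoly.
pose h (p : {poly_(alpha - k) F}) : trunc_poly F alpha :=
  in_qpoly 'X^alpha ((p : {poly F}) * 'X^k).
have sizeh (p : {poly_(alpha - k) F}) :
    (size ((p : {poly F}) * 'X^k)%R <= alpha)%N.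
  have [->|nz] := eqVneq (p : {poly F}) 0; first by rewrite mul0r size_poly0.
  by rewrite size_mulXn // -leq_subRL // size_npoly.
rewrite -cardsT -(card_imset _ (_ : injective h)).
  apply: eq_card => x; rewrite !inE; apply/idP/imsetP => [/dvdpP[p def_x]|].
    have sp : (size p <= alpha - k)%N.
      have [->|nz] := eqVneq p 0; first by rewrite size_poly0.
      have := size_trunc alpha_gt0 x.
      by rewrite def_x size_mulXn // leq_subRL.
    exists (NPoly sp); rewrite ?inE // /h /= -def_x truncK //.
  by case=> p _ ->; rewrite tdvd_trunc // dvdp_mulIr.
move=> p1 p2 /(congr1 (fun x : trunc_poly F alpha => (x : {poly F}))).
rewrite /h !trunc_small // => /eqP.
have Xk0 : ('X^k : {poly F}) != 0 by rewrite monic_neq0 ?monicXn.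
by rewrite (inj_eq (mulIf Xk0)) => /eqP/val_inj.
Qed.

(** * Gauge classes of labellings and contraction of arrows *)

(** Connectedness is stated through two-colourings, the form in which direct sum
decompositions meet it. Contraction keeps the vertex type and shrinks the set S
of vertices that are still present, so constancy is required on S only. *)
Definition connects (V A : finType) (O : nzRingType) (S : {set V})
    (s t : A -> V) (f : A -> O) : Prop :=
  forall c : V -> bool, (forall a, f a != 0 -> c (s a) = c (t a)) ->
  {in S &, forall x y, c x = c y}.

Section NormalForms.
Variables (V A : finType) (alpha : nat).
Hypothesis alpha_gt0 : (0 < alpha)%N.
Implicit Types (s t : A -> V) (m : A -> nat) (e a : A) (v : nat).

Definition contract s t e (x : V) : V := if x == t e then s e else x.

(** The divisibility bounds left once e is known to be the first non-loop of least
valuation v: alpha at e, which kills the label of the contracted arrow so that it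
contributes a factor 1, and at least v or v + 1 at the other non-loops, according
to the tie-breaking order. *)
Definition raise s t m v e a : nat :=
  if s a == t a then m a
  else if a == e then alpha
  else maxn (m a) (v + (enum_rank a < enum_rank e)).

(** The recursion is on the number of vertices minus one; p.1 is the first
non-loop of least valuation and p.2 is that valuation. *)
Fixpoint orbit_poly n s t m : {poly int} :=
  if n is n'.+1 then
    \sum_(p : A * 'I_alpha)
      if (s p.1 != t p.1) && (m p.1 <= p.2)%N then
        orbit_poly n' (contract s t p.1 \o s) (contract s t p.1 \o t)
          (raise s t m p.2 p.1)
      else 0
  else 'X^(\sum_a (alpha - m a)).

Lemma orbit_poly_nneg n s t m : orbit_poly n s t m \is a polyOver Num.nneg.
Proof.
elim: n s t m => [|n IHn] s t m /=; apply/polyOverP => i; rewrite nnegrE.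
  by rewrite coefXn ler0n.
rewrite coef_sum; apply: sumr_ge0 => p _; case: ifP => _; last by rewrite coef0.
by rewrite -nnegrE; apply/polyOverP: i; apply: IHn.
Qed.

Variable F : finFieldType.
Local Notation O := (trunc_poly F alpha).
Local Notation "''t^' k" := (tpow F alpha k) (at level 8, k at level 2).
Implicit Types (f z : {ffun A -> O}) (S : {set V}).

Definition set_at f e x : {ffun A -> O} := [ffun a => if a == e then x else f a].

Fixpoint normal_forms n s t m : {set {ffun A -> O}} :=
  if n is n'.+1 then
    \bigcup_(p : A * 'I_alpha)
      if (s p.1 != t p.1) && (m p.1 <= p.2)%N then
        [set set_at z p.1 't^(p.2) | z in
          normal_forms n' (contract s t p.1 \o s) (contract s t p.1 \o t)
            (raise s t m p.2 p.1)]
      else set0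
  else [set f : {ffun A -> O} | [forall a, tdvd (m a) (f a)]].

Definition bounded m f := forall a, tdvd (m a) (f a).

Definition gauge s t f f' : Prop :=
  exists2 g : V -> O, (forall i, g i \is a GRing.unit) &
    forall a, f a * g (t a) = g (s a) * f' a.

(** The first step of the algorithm: e is least among the non-loops for the
lexicographic order on (valuation, rank), and v is its valuation. The last
two conditions together force v < alpha, see leads_lt. *)
Definition leads s t e v f : Prop :=
  [/\ s e != t e, ~~ tdvd v.+1 (f e) &
      forall a, s a != t a -> tdvd (v + (enum_rank a < enum_rank e)) (f a)].

Lemma gauge_refl s t f : gauge s t f f.
Proof.
by exists (fun=> 1) => [i|a]; rewrite ?unitr1 // mulr1 mul1r.
Qed.

Lemma gauge_sym s t f f' : gauge s t f f' -> gauge s t f' f.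
Proof.
case=> g gU gE; exists (fun i => (g i)^-1) => [i|a]; first by rewrite unitrV.
apply: (mulrI (gU (s a))); rewrite mulrA -gE mulrK // mulrA divrr ?mul1r //.
Qed.

Lemma gauge_trans s t f1 f2 f3 :
  gauge s t f1 f2 -> gauge s t f2 f3 -> gauge s t f1 f3.
Proof.
case=> g gU gE [h hU hE]; exists (fun i => g i * h i) => [i|a].
  by rewrite unitrM gU hU.
by rewrite mulrA gE -mulrA hE mulrA.
Qed.

Lemma gauge_tdvd s t f f' k a : gauge s t f f' -> tdvd k (f' a) = tdvd k (f a).
Proof.
case=> g gU gE.
by rewrite -(tdvd_unitM alpha_gt0 k (f' a) (gU (s a))) -gE mulrC tdvd_unitM.
Qed.

Lemma gauge_eq0 s t f f' a : gauge s t f f' -> (f' a == 0) = (f a == 0).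
Proof.
by move=> R; rewrite -!(tdvd_eq0 alpha_gt0 _ (leqnn _)) (gauge_tdvd _ _ R).
Qed.

Lemma gauge_bounded s t m f f' : gauge s t f f' -> bounded m f -> bounded m f'.
Proof. by move=> R bf a; rewrite (gauge_tdvd _ _ R). Qed.

Lemma gauge_connects S s t f f' :
  gauge s t f f' -> connects S s t f -> connects S s t f'.
Proof.
by move=> R cf c cP; apply: cf => a fa; apply: cP; rewrite (gauge_eq0 _ R).
Qed.

Lemma gauge_leads s t e v f f' :
  gauge s t f f' -> leads s t e v f -> leads s t e v f'.
Proof.
move=> R [nl nd le]; split=> //; first by rewrite (gauge_tdvd _ _ R).
by move=> a nla; rewrite (gauge_tdvd _ _ R) le.
Qed.

Lemma leads_dvd s t e v f : leads s t e v f -> tdvd v (f e).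
Proof. by case=> nl _ /(_ e nl); rewrite ltnn addn0. Qed.

Lemma leads_lt s t e v f : leads s t e v f -> (v < alpha)%N.
Proof.
move=> L; rewrite ltnNge; apply/negP => le_av.
case: (L) => _ /negP[]; rewrite tdvd_eq0 ?(leqW le_av) //.
by rewrite -(tdvd_eq0 alpha_gt0 _ le_av) (leads_dvd L).
Qed.

(** With two vertices left, a connected support contains a non-loop: otherwise the
indicator of a single vertex is an admissible colouring. *)
Lemma leads_exists S s t f :
  connects S s t f -> (1 < #|S|)%N -> exists e v, leads s t e v f.
Proof.
move=> cf /card_gt1P[x [y [xS yS neq_xy]]].
(* v is the least valuation of a non-loop, e the first non-loop attaining it *)
pose P v := [exists e, (s e != t e) && ~~ tdvd v.+1 (f e)].
have exP : exists v, P v.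
  exists alpha; apply/existsP; apply: contrapT => noe.
  move/negP: neq_xy; apply; apply/eqP.
  suff : (x == x) = (y == x) by rewrite eqxx => /esym/eqP.
  apply: (cf (fun i => i == x)) => // a nz; congr (_ == x).
  have [//|nl] := eqVneq (s a) (t a); case: noe.
  by exists a; rewrite nl tdvd_eq0.
have [v /existsP[e0 He0] minv] := ex_minnP exP.
pose B e := (s e != t e) && ~~ tdvd v.+1 (f e).
case: (@arg_minnP _ e0 B (fun e => enum_rank e : nat) He0) => e /andP[nl nd] mine.
exists e, v; split=> // a nla; case: ltnP => [lt_ae|_].
  rewrite addn1; apply: contraLR lt_ae => ndv; rewrite -leqNgt.
  by apply: mine; rewrite /B nla.
rewrite addn0; case: v minv {nd mine He0 B} => [|v] minv.
  by rewrite /tdvd expr0 dvd1p.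
apply: contraT => ndv; have := minv v; rewrite ltnn => -> //.
by apply/existsP; exists a; rewrite nla.
Qed.

(** The unit part of f_e is absorbed by its source; this leaves f_e = t^v because
e is not a loop. *)
Lemma gauge_pivot s t e v f : leads s t e v f ->
  exists2 f', gauge s t f f' & f' e = 't^v.
Proof.
move=> L; have [nl nd _] := L.
have [u uU def_fe] := exact_tdvd alpha_gt0 (leads_dvd L) nd.
pose g (x : V) : O := if x == s e then u else 1.
have gU x : g x \is a GRing.unit by rewrite /g; case: ifP; rewrite ?unitr1.
exists [ffun a => (g (s a))^-1 * (f a * g (t a))].
  by exists g => // a; rewrite ffunE mulVKr.
by rewrite ffunE /g eqxx eq_sym (negPf nl) mulr1 def_fe mulKr.
Qed.

Lemma leads_uniq s t e v e' v' f :
  leads s t e v f -> leads s t e' v' f -> e = e' /\ v = v'.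
Proof.
move=> [nl nd le] [nl' nd' le'].
have lt_of k j (x : O) : tdvd k x -> ~~ tdvd j.+1 x -> (k <= j)%N.
  by move=> dk; apply: contraR; rewrite -ltnNge => lt; apply: tdvdW dk.
have {}le := lt_of _ _ _ (le _ nl') nd'.
have {}le' := lt_of _ _ _ (le' _ nl) nd.
move: le le'; case: (ltngtP (enum_rank e) (enum_rank e')) => [|| /ord_inj].
- by rewrite addn0 addn1 => _ le le'; have := leq_trans le' le; rewrite ltnn.
- by rewrite addn0 addn1 => _ le le'; have := leq_trans le le'; rewrite ltnn.
move/enum_rank_inj=> ->; rewrite !addn0 => le le'; split=> //.
by apply/eqP; rewrite eqn_leq le le'.
Qed.

Section Contraction.
Variables (S : {set V}) (s t : A -> V) (m : A -> nat) (e : A) (v : nat).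
Hypotheses (nonloop : s e != t e) (lt_v : (v < alpha)%N) (le_mv : (m e <= v)%N).
Local Notation rho := (contract s t e).
Local Notation s' := (rho \o s).
Local Notation t' := (rho \o t).
Local Notation m' := (raise s t m v e).

Lemma contract_src : rho (s e) = rho (t e).
Proof. by rewrite /contract eqxx (negPf nonloop). Qed.

Lemma contract_in x : s e \in S -> x \in S -> rho x \in S :\ t e.
Proof.
by rewrite /contract !inE; case: (eqVneq x (t e)) => [_|->]; rewrite ?nonloop.
Qed.

Lemma bounded_raise_eq0 z : bounded m' z -> z e = 0.
Proof.
move=> /(_ e); rewrite /raise (negPf nonloop) eqxx tdvd_eq0 //.
by move/eqP.
Qed.

Lemma bounded_raise_nonloop z a : bounded m' z -> s a != t a -> tdvd v (z a).
Proof.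
move=> /(_ a); rewrite /raise => bz nl; move: bz; rewrite (negPf nl).
case: eqP => _; first by apply: tdvdW; apply: ltnW.
by apply: tdvdW; apply: leq_trans (leq_addr _ v) (leq_maxr _ _).
Qed.

Lemma bounded_set_at z : bounded m' z -> bounded m (set_at z e 't^v).
Proof.
move=> bz a; rewrite ffunE; case: eqP => [->|/eqP ne]; first by rewrite tdvd_tpow.
have := bz a; rewrite /raise (negPf ne); case: ifP => // _.
by apply: tdvdW; rewrite leq_maxl.
Qed.

Lemma leads_set_at z : bounded m' z -> leads s t e v (set_at z e 't^v).
Proof.
move=> bz; split=> [||a nl]; rewrite // ffunE ?eqxx ?tdvd_tpow ?ltnn //.
case: eqP => [->|/eqP ne]; first by rewrite ltnn addn0 tdvd_tpow.
have := bz a; rewrite /raise (negPf nl) (negPf ne).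
by apply: tdvdW; rewrite leq_maxr.
Qed.

(** Being first is exactly what makes f obey the raised bounds. *)
Lemma bounded_del f : leads s t e v f -> bounded m f -> bounded m' (set_at f e 0).
Proof.
move=> [_ _ le] bf a; rewrite ffunE /raise.
case: (eqVneq a e) => [_|ne]; first exact: dvdp0.
case: ifP => [_ //|/negbT nl].
by rewrite /maxn; case: ifP => _; [apply: le | apply: bf].
Qed.

(** The colourings for the two quivers correspond: an admissible colouring before
contraction agrees at the ends of e since t^v <> 0, so it factors through the
contraction. *)
Lemma connects_set_at z : s e \in S ->
  connects (S :\ t e) s' t' z -> connects S s t (set_at z e 't^v).
Proof.
move=> seS cz c cP.
have ce : c (s e) = c (t e) by apply: cP; rewrite ffunE eqxx tpow_neq0.
have crho x : c (rho x) = c x by rewrite /contract; case: eqP => // ->.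
move=> x y /(contract_in seS) xS /(contract_in seS) yS; rewrite -(crho x) -(crho y).
apply: cz => // a nz; rewrite /= !crho; have [->//|ne] := eqVneq a e.
by apply: cP; rewrite ffunE (negPf ne).
Qed.

Lemma connects_del f :
  connects S s t f -> connects (S :\ t e) s' t' (set_at f e 0).
Proof.
move=> cf c cP x y; rewrite !inE => /andP[nx xS] /andP[ny yS].
have rhoK w : w != t e -> rho w = w by rewrite /contract => /negPf ->.
rewrite -(rhoK x nx) -(rhoK y ny); apply: (cf (c \o rho)) => // a nz /=.
have [->|ne] := eqVneq a e; first by rewrite contract_src.
by apply: cP; rewrite ffunE (negPf ne).
Qed.

(** A gauge transformation of the contracted quiver, pulled back to the original
one, takes equal values at both ends of e and so fixes t^v. *)
Lemma gauge_lift f z : f e = 't^v ->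
  gauge s' t' (set_at f e 0) z -> gauge s t f (set_at z e 't^v).
Proof.
move=> fe [g gU gE]; exists (g \o rho) => [i|a]; first exact: gU.
have := gE a; rewrite !ffunE /=; case: eqP => [->|//] _.
by rewrite contract_src fe mulrC.
Qed.

(** Conversely, a transformation fixing t^v at e has t^v g_i = t^v g_j at the ends
of e. Every other non-loop carries a multiple of t^v, on which g_i and g_j thus
act alike, and the action on a loop is trivial; so g itself, restricted to the
remaining vertices, relates the contracted labellings. *)
Lemma gauge_descend z1 z2 : bounded m' z1 -> bounded m' z2 ->
  gauge s t (set_at z1 e 't^v) (set_at z2 e 't^v) -> gauge s' t' z1 z2.
Proof.
move=> b1 b2 [g gU gE]; exists g => // a.
have [->|ne] := eqVneq a e; first by rewrite !bounded_raise_eq0 // mul0r mulr0.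
have := gE e; rewrite !ffunE eqxx => ge.
have stab x w : tdvd v x -> x * g (rho w) = x * g w.
  move=> /(tdvdP alpha_gt0)[y ->]; rewrite /contract; case: eqP => // ->.
  by rewrite -!mulrA ge [g _ * _]mulrC.
have := gE a; rewrite !ffunE (negPf ne) /=.
have [loop|nl] := eqVneq (s a) (t a).
  rewrite loop mulrC => /(mulrI (gU _)) ->; exact: mulrC.
by rewrite stab 1?[g (rho _) * _]mulrC ?stab 1?[z2 a * _]mulrC //;
  apply: bounded_raise_nonloop.
Qed.

End Contraction.

Lemma normal_forms_bounded n s t m z :
  z \in normal_forms n s t m -> bounded m z.
Proof.
elim: n s t m z => [|n IHn] s t m z /=; first by rewrite inE => /forallP.
case/bigcupP=> -[e v] _ /=; case: ifP => [/andP[nl le_mv]|_]; last by rewrite inE.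
by case/imsetP=> z' /IHn bz' ->; apply: bounded_set_at.
Qed.

Lemma normal_formsS n s t m z : z \in normal_forms n.+1 s t m ->
  exists (p : A * 'I_alpha) (z' : {ffun A -> O}),
    [/\ s p.1 != t p.1, (m p.1 <= p.2)%N,
       z' \in normal_forms n (contract s t p.1 \o s) (contract s t p.1 \o t)
         (raise s t m p.2 p.1)
     & z = set_at z' p.1 't^(p.2)].
Proof.
case/bigcupP=> p _; case: ifP => [/andP[nl le_mv]|_]; last by rewrite inE.
by case/imsetP=> z' z'N ->; exists p, z'.
Qed.

Lemma card_contract n S s t e : (forall a, t a \in S) ->
  #|S| = n.+2 -> #|S :\ t e| = n.+1.
Proof. by move=> tS; rewrite (cardsD1 (t e)) tS => -[]. Qed.

Lemma normal_forms_connects n S s t m z :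
    #|S| = n.+1 -> (forall a, s a \in S) -> (forall a, t a \in S) ->
  z \in normal_forms n s t m -> connects S s t z.
Proof.
elim: n S s t m z => [|n IHn] S s t m z cardS sS tS.
  move=> _ c _ x y.
  by have /eqP/cards1P[w ->] := cardS; rewrite !inE => /eqP-> /eqP->.
case/normal_formsS=> -[e v] [z' [/= nl le_mv z'N ->]].
apply: connects_set_at => //; apply: IHn z'N; first exact: card_contract cardS.
- by move=> a; apply: contract_in.
- by move=> a; apply: contract_in.
Qed.

(** Move f to make its leading label t^v, contract, normalise there and lift. *)
Lemma normal_forms_cover n S s t m f :
    #|S| = n.+1 -> (forall a, s a \in S) -> (forall a, t a \in S) ->
    bounded m f -> connects S s t f ->
  exists2 z, z \in normal_forms n s t m & gauge s t f z.
Proof.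
elim: n S s t m f => [|n IHn] S s t m f cardS sS tS bf cf.
  by exists f; [rewrite inE; apply/forallP | apply: gauge_refl].
have [|e [v L]] := leads_exists cf; first by rewrite cardS.
have [f1 Rf f1e] := gauge_pivot L.
have {}L := gauge_leads Rf L; have lt_v := leads_lt L; have [nl _ _] := L.
have {}bf := gauge_bounded Rf bf; have {}cf := gauge_connects Rf cf.
have le_mv : (m e <= v)%N by rewrite -(tdvd_tpow F alpha_gt0) // -f1e.
have [||| z' z'N Rz'] := IHn (S :\ t e) _ _ _ _ _ _ _
  (bounded_del L bf) (connects_del nl cf).
- exact: card_contract cardS.
- by move=> a; apply: contract_in.
- by move=> a; apply: contract_in.
exists (set_at z' e 't^v); last by apply: gauge_trans Rf (gauge_lift _ _ Rz').
apply/bigcupP; exists (e, Ordinal lt_v) => //=; rewrite nl le_mv.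
exact: imset_f.
Qed.

(** Two normal forms in one orbit have the same leading arrow and valuation, as
these are gauge invariant; the rest descends to the contraction. With one vertex
left, commutativity makes the action trivial. *)
Lemma normal_forms_inj n S s t m z1 z2 :
    #|S| = n.+1 -> (forall a, s a \in S) -> (forall a, t a \in S) ->
    z1 \in normal_forms n s t m -> z2 \in normal_forms n s t m ->
  gauge s t z1 z2 -> z1 = z2.
Proof.
elim: n S s t m z1 z2 => [|n IHn] S s t m z1 z2 cardS sS tS.
  move=> _ _ [g gU gE]; apply/ffunP => a; apply: (mulrI (gU (s a))).
  rewrite -gE mulrC; congr (_ * g _).
  have /eqP/cards1P[w defS] := cardS.
  by move: (sS a) (tS a); rewrite defS !inE => /eqP-> /eqP->.
case/normal_formsS=> -[e v] [w1 [/= nl le_mv w1N ->]].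
case/normal_formsS=> -[e' v'] [w2 [/= nl' le_mv' w2N ->]] R.
have b1 := normal_forms_bounded w1N; have b2 := normal_forms_bounded w2N.
have L1 := gauge_leads R (leads_set_at nl (ltn_ord v) b1).
have L2 := leads_set_at nl' (ltn_ord v') b2.
have [eq_e /val_inj eq_v] := leads_uniq L1 L2.
move: e' v' eq_e eq_v w2N b2 R {nl' le_mv' L1 L2} => _ _ <- <- w2N b2 R.
congr set_at; apply: (IHn (S :\ t e)) w1N w2N _.
- exact: card_contract cardS.
- by move=> a; apply: contract_in.
- by move=> a; apply: contract_in.
exact: gauge_descend R.
Qed.

(** The union over (e, v) is disjoint since a labelling has at most one leading
pair; a normal form recovers its contraction because the latter vanishes at e. *)
Lemma card_normal_forms n s t m :
  #|normal_forms n s t m|%:R = (orbit_poly n s t m).[#|F|%:R] :> int.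
Proof.
elim: n s t m => [|n IHn] s t m.
  rewrite /= hornerXn -natrX; congr (_%:R).
  transitivity #|family (fun a => [set x : O | tdvd (m a) x])|.
    by apply: eq_card => f; rewrite !inE; apply: eq_forallb => a; rewrite inE.
  rewrite card_family foldrE big_map big_enum expn_sum /=.
  by apply: eq_bigr => a _; rewrite card_tdvd.
rewrite -sum1_card partition_disjoint_bigcup /=; last first.
  move=> [e v] [e' v'] /= ne; rewrite -setI_eq0; apply: contraNT ne.
  case/set0Pn=> z; rewrite inE; case/andP.
  case: ifP => [/andP[nl le_mv]|_]; last by rewrite inE.
  case: ifP => [/andP[nl' le_mv']|_]; last by rewrite inE.
  case/imsetP=> w1 /normal_forms_bounded b1 -> /imsetP[w2 w2N def_w].
  have L1 := leads_set_at nl (ltn_ord v) b1.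
  have := leads_set_at nl' (ltn_ord v') (normal_forms_bounded w2N).
  by rewrite -def_w => /(leads_uniq L1)[-> /val_inj->].
rewrite natr_sum horner_sum; apply: eq_bigr => -[e v] _ /=.
case: ifP => [/andP[nl le_mv]|_]; last by rewrite big_set0 horner0.
rewrite -IHn sum1_card card_in_imset // => w1 w2 w1N w2N eq_w.
apply/ffunP => a; have := congr1 (fun f : {ffun A -> O} => f a) eq_w.
rewrite !ffunE; case: eqP => // -> _.
by rewrite (bounded_raise_eq0 nl (normal_forms_bounded w1N))
   (bounded_raise_eq0 nl (normal_forms_bounded w2N)).
Qed.

End NormalForms.

(** * Indecomposability in rank one *)

Lemma card_transversal (T T' : finType) (R : rel T) (D : {set T})
    (Z : {set T'}) (h : T' -> T) :
    {in D & &, equivalence_rel R} ->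
    {in Z, forall z, h z \in D} ->
    {in D, forall x, exists2 z, z \in Z & R x (h z)} ->
    {in Z &, forall z1 z2, R (h z1) (h z2) -> z1 = z2} ->
  #|equivalence_partition R D| = #|Z|.
Proof.
move=> eqR hD cover inj; pose cls z := [set y in D | R (h z) y].
have eqvP x y : x \in D -> y \in D -> R x y ->
    forall z, z \in D -> R x z = R y z.
  by move=> xD yD Rxy z zD; apply: (eqR x y z xD yD zD).2.
have Rxx x : x \in D -> R x x by move=> xD; exact: (eqR x x x xD xD xD).1.
rewrite -(card_in_imset (f := cls)) => [|z1 z2 z1Z z2Z eq_cls]; last first.
  have : h z2 \in cls z1 by rewrite eq_cls inE hD // Rxx ?hD.
  by rewrite inE hD //= => /inj->.
apply: eq_card => B; apply/imsetP/imsetP => [[x xD ->]|[z zZ ->]].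
  have [z zZ Rxz] := cover x xD; exists z => //.
  apply/setP => y; rewrite !inE; apply: andb_id2l => yD.
  by apply: eqvP => //; apply: hD.
by exists (h z); first exact: hD.
Qed.

(** Splitting the generator 1 at a vertex as u + w, one of u and w is a unit, so one
summand is everything there and the other is zero. A decomposition is therefore
a colouring of the vertices by the summand that owns them, and a non-zero
label prevents its ends from having different owners. *)
Lemma indecomposable_rank1 (Q : quiver) (L : comUnitRingType)
    (N : rep (fun _ : vertex Q => 1%N) L) :
    (forall u w : L, u + w = 1 ->
       (u \is a GRing.unit) || (w \is a GRing.unit)) ->
  indecomposable N <->
  (exists i : vertex Q, True) /\
    connects setT (@src Q) (@tgt Q) (fun a => N a 0 0).
Proof.
pose e : 'rV[L]_1 := const_mx 1.
have nze : e != 0.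
  by apply/eqP => /matrixP/(_ 0 0)/eqP; rewrite !mxE oner_eq0.
move=> local; split=> [[[i0 _] indec]|[[i0 _] conn]]; last first.
  split; first by exists i0; exists e.
  case=> U [W [[subU actU] [subW actW] [iU [u uU nzu]] [iW [w wW nzw]] dec]].
  have full (X : vertex_sub (fun _ : vertex Q => 1%N) L) i v :
      submod_closed (X i) -> (exists2 x, x \in X i & x 0 0 \is a GRing.unit) ->
      v \in X i.
    case=> X0 Xlin [x xX xU]; have := Xlin (v 0 0 / x 0 0) _ _ xX X0.
    rewrite addr0; congr (_ \in X i); apply/matrixP => j k.
    by rewrite mxE !ord1 divrK.
  have eU : e 0 0 \is a GRing.unit by rewrite mxE unitr1.
  have splitUW i : (e \in U i) || (e \in W i).
    have [x [y [xU yW def_e]]] := (dec i).1 e.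
    have : x 0 0 + y 0 0 = 1 by move/matrixP/(_ 0 0): def_e; rewrite !mxE.
    by case/local/orP => inv; apply/orP; [left|right]; apply: full => //; eexists; eauto.
  have exclusive i v : v != 0 -> v \in U i -> v \in W i -> false.
    by move=> nz vU vW; rewrite (eqP (introT eqP ((dec i).2 v vU vW))) eqxx in nz.
  have fullU i v : e \in U i -> v \in U i by move=> eUi; apply: full => //; exists e.
  have fullW i v : e \in W i -> v \in W i by move=> eWi; apply: full => //; exists e.
  have cP (a : arrow Q) : N a 0 0 != 0 -> (e \in U (src a)) = (e \in U (tgt a)).
    move=> nz; have nzN : e *m N a != 0.
      apply: contraNneq nz => /matrixP/(_ 0 0).
      by rewrite !mxE big_ord1 mxE mul1r => ->.
    apply/idP/idP => [eS|eT].
      case/orP: (splitUW (tgt a)) => // /fullW eT.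
      by case: (exclusive _ _ nzN (actU _ _ eS) (eT _)).
    case/orP: (splitUW (src a)) => // eS.
    by case: (exclusive _ _ nzN (fullU _ _ eT) (actW _ _ eS)).
  have const := conn (fun i => e \in U i) cP.
  have [eW|/negbTE eW] := boolP (e \in U iW).
    by case: (exclusive _ _ nzw (fullU _ _ eW) wW).
  have := splitUW iU; rewrite (const iU iW) ?inE // eW => /fullW eU'.
  by case: (exclusive _ _ nzu uU (eU' _)).
split=> [|c cP x y _ _]; first by exists i0.
apply: contrapT => neq_c; apply: indec.
(* the two colour classes give complementary subrepresentations *)
pose X (b : bool) : vertex_sub (fun _ : vertex Q => 1%N) L :=
  fun i => [pred v | (c i == b) || (v == 0)].
have subX b : subrep N (X b).
  split=> [i|a v]; rewrite ?inE.
    split=> [|k v w]; rewrite !inE ?eqxx ?orbT //.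
    by case: (c i == b) => //= /eqP-> /eqP->; rewrite scaler0 addr0.
  have [Na0|nz] := eqVneq (N a) 0; first by rewrite Na0 mulmx0 eqxx orbT.
  rewrite cP; last first.
    by apply: contraNneq nz => Na0; apply/eqP/matrixP => j k; rewrite !ord1 Na0 mxE.
  by case/orP=> [->//|/eqP->]; rewrite mul0mx eqxx orbT.
have nzX j : sub_nonzero (X (c j)).
  by exists j; exists e; rewrite ?inE ?eqxx.
exists (X (c x)), (X (c y)); split=> // j.
have cj : (c j == c x) = ~~ (c j == c y).
  by move/eqP: neq_c; case: (c j); case: (c x); case: (c y).
split=> v; last first.
  by rewrite !inE cj; case: (c j == c y) => /= [/eqP|_ /eqP].
have [cjx|cjx] := boolP (c j == c x).
  by exists v, 0; split; rewrite ?inE ?cjx ?eqxx ?orbT ?addr0.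
exists 0, v; split; rewrite ?inE ?eqxx ?orbT ?add0r //.
by move: cjx; rewrite cj negbK => ->.
Qed.

(** Base change preserves supports because coefficients are mapped injectively. *)
Lemma trunc_map_eq0 (F K : fieldType) (f : {rmorphism F -> K}) alpha
    (x : trunc_poly F alpha) : (0 < alpha)%N -> (trunc_map f x == 0) = (x == 0).
Proof.
move=> alpha_gt0.
have mapE : (trunc_map f x : {poly K}) = map_poly f x.
  by apply: trunc_small => //; rewrite size_map_poly size_trunc.
transitivity ((trunc_map f x : {poly K}) == 0).
  by rewrite -(inj_eq val_inj).
by rewrite mapE map_poly_eq0.
Qed.

(** * The counting polynomial *)

Section RankOneRepresentations.
Variables (Q : quiver) (alpha : nat).
Hypothesis alpha_gt0 : (0 < alpha)%N.
Local Notation r1 := (fun _ : vertex Q => 1%N).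

Definition entries (O : nzRingType) (M : rep r1 O) : {ffun arrow Q -> O} :=
  [ffun a => M a 0 0].

Definition rep_of_entries (O : nzRingType) (f : {ffun arrow Q -> O}) : rep r1 O :=
  [ffun a => const_mx (f a)].

Lemma rep_of_entriesK (O : nzRingType) : cancel (@rep_of_entries O) (@entries O).
Proof. by move=> f; apply/ffunP => a; rewrite !ffunE mxE. Qed.

Lemma rep_iso_gauge (F : finFieldType) (M N : rep r1 (trunc_poly F alpha)) :
  rep_iso M N <-> gauge (@src Q) (@tgt Q) (entries M) (entries N).
Proof.
split=> [[g [gU gE]]|[g gU gE]].
  exists (fun i => g i 0 0) => [i|a].
    by have := gU i; rewrite unitmxE det_mx11.
  by have /matrixP/(_ 0 0) := gE a; rewrite !mxE !big_ord1 !ffunE.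
exists (fun i => (g i)%:M); split=> [i|a]; first by rewrite unitmxE det_scalar1.
apply/matrixP => i j; rewrite !ord1 !mxE !big_ord1 !mxE eqxx !mulr1n.
by have := gE a; rewrite !ffunE.
Qed.

Lemma abs_indecomposable_connects (F : finFieldType)
    (M : rep r1 (trunc_poly F alpha)) :
  abs_indecomposable M <->
  (exists i : vertex Q, True) /\ connects setT (@src Q) (@tgt Q) (entries M).
Proof.
apply: iff_trans (indecomposable_rank1 _ _) _; first exact: trunc_local.
have supp a : (entries M a != 0) =
    (base_change (@trunc_map F _ (to_alg_closure F) alpha) M a 0 0 != 0).
  by rewrite !ffunE mxE trunc_map_eq0.
by split=> -[V0 conn]; split=> // c cP; apply: conn => a; [rewrite -supp|rewrite supp];
  apply: cP.
Qed.

(** At the start all vertices are present and no divisibility is imposed. Without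
vertices the only representation is zero, which is not indecomposable. *)
Definition kac_polynomial : {poly int} :=
  if #|vertex Q| is n.+1 then
    orbit_poly alpha n (@src Q) (@tgt Q) (fun=> 0%N)
  else 0.

Lemma kac_polynomial_counts : counting_polynomial r1 alpha kac_polynomial.
Proof.
move=> F; rewrite /count_abs_indec /kac_polynomial.
set D := [set M | _]; set R := (X in equivalence_partition X).
have DE M : M \in D <->
    (exists i : vertex Q, True) /\ connects setT (@src Q) (@tgt Q) (entries M).
  rewrite inE; apply: iff_trans (abs_indecomposable_connects M).
  by split=> /asboolP.
have RE M N : R M N <-> gauge (@src Q) (@tgt Q) (entries M) (entries N).
  by apply: iff_trans (rep_iso_gauge M N); split=> /asboolP.
case cardV: #|vertex Q| => [|n].
  have -> : D = set0.
    apply/setP => M; rewrite in_set0; apply/negP => /DE[[i _] _].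
    by have := fintype0 i cardV.
  by rewrite /equivalence_partition imset0 cards0 horner0.
rewrite -card_normal_forms //; congr (_%:R); symmetry.
have bounded0 (f : {ffun arrow Q -> trunc_poly F alpha}) : bounded (fun=> 0%N) f.
  by move=> a; rewrite /tdvd expr0 dvd1p.
have cardT : #|[set: vertex Q]| = n.+1 by rewrite cardsT.
have inT (h : arrow Q -> vertex Q) a : h a \in setT by rewrite inE.
apply: (card_transversal (h := @rep_of_entries _)) => [M N P MD ND PD|z zN|M /DE|].
- split=> [|/RE gMN]; first exact/RE/gauge_refl.
  apply/idP/idP => /RE gP; apply/RE; last exact: gauge_trans gMN gP.
  exact: gauge_trans (gauge_sym gMN) gP.
- apply/DE; split; last first.
    by rewrite rep_of_entriesK; apply: (normal_forms_connects _ cardT) zN.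
  by have /card_gt0P[i _] : (0 < #|vertex Q|)%N; [rewrite cardV | exists i].
- case=> _ conn.
  have [z zN gz] := normal_forms_cover alpha_gt0 cardT (inT _) (inT _) (bounded0 _) conn.
  by exists z => //; apply/RE; rewrite rep_of_entriesK.
move=> z1 z2 z1N z2N /RE; rewrite !rep_of_entriesK.
exact: (normal_forms_inj alpha_gt0 cardT (inT _) (inT _) z1N z2N).
Qed.

Lemma counting_polynomial_unique (A B : {poly int}) :
  counting_polynomial r1 alpha A -> counting_polynomial r1 alpha B -> A = B.
Proof.
move=> cA cB; apply/eqP; rewrite -subr_eq0; apply: contraT => nz.
(* A - B vanishes at the orders of the fields with 2^k elements, too many points *)
pose rs := [seq ((2 ^ k)%N%:R : int) | k <- iota 1 (size (A - B))].
have : (size rs < size (A - B)%R)%N.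
  apply: max_poly_roots => //; last first.
    by rewrite map_inj_uniq ?iota_uniq // => i j /eqP; rewrite eqr_nat eqn_exp2l // => /eqP.
  apply/allP => _ /mapP[k + ->]; rewrite mem_iota => /andP[k_gt0 _].
  have [F _ <-] := pPrimePowerField (isT : prime 2) k_gt0.
  by rewrite /root !hornerE cA cB subrr.
by rewrite size_map size_iota ltnn.
Qed.

End RankOneRepresentations.

Theorem theorem1p0p5 (Q : quiver) (alpha : nat) (alpha_ge1 : (1 <= alpha)%N) :
  exists A : {poly int},
    unique (counting_polynomial (fun _ : vertex Q => 1%N) alpha) A /\
    A \is a polyOver Num.nneg.
Proof.
exists (kac_polynomial Q alpha); split; last first.
  rewrite /kac_polynomial; case: #|_| => [|n]; last exact: orbit_poly_nneg.
  by apply/polyOverP => i; rewrite coef0 nnegrE.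
split=> [|B countsB]; first by apply: kac_polynomial_counts.
by apply: counting_polynomial_unique countsB; apply: kac_polynomial_counts.
Qed.
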